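(* The sequence $\left\{\frac{1}{\sqrt[n]{|B_{2n}|}}\right\}_{n\geq 1}$ is almost infinitely log-monotonic, where $B_{2n}$ is the $2n$th Bernoulli number.
   Context: The Bernoulli numbers are defined by $B_0=1$ and $\sum_{k=0}^{n}\binom{n+1}{k}B_k=0$ for all integers $n\ge 1$. A sequence $\{a_n\}$ of positive real numbers is log-concave if $a_{n+1}^2\ge a_na_{n+2}$ for all $n$, and log-convex if $a_{n+1}^2\le a_na_{n+2}$ for all $n$. Define an operator $R$ on sequences of positive reals by $R\{z_n\}=\{x_n\}$ with $x_n=z_{n+1}/z_n$, and let $R^r$ be its $r$-fold iterate ($R^0$ is the identity). A sequence $\{z_n\}$ is infinitely log-monotonic if $R^r\{z_n\}$ is log-concave for all odd $r$ and log-convex for all even $r\ge 0$. It is almost infinitely log-monotonic if this holds at each order except for certain terms at the beginning, i.e. for every integer $r\ge 0$ there is $N_r$ such that the sequence $R^r\{z_n\}$ restricted to indices $n\ge N_r$ is log-convex if $r$ is even and log-concave if $r$ is odd. *)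

(* Defs.v *)
From Stdlib Require Import Reals Lra Lia Arith.
Open Scope R_scope.

(* [bernoulli_upto n k] is B_k for k <= n.  The relation
   sum_{k=0}^{n} binom(n+1,k) B_k = 0 is solved for its last term
   binom(n+1,n) B_n = (n+1) B_n.  [C] is Stdlib's binomial coefficient and
   [sum_f_R0 f m] is f 0 + ... + f m. *)
Fixpoint bernoulli_upto (n : nat) : nat -> R :=
  match n with
  | O => fun _ => 1
  | S m => fun k =>
      if Nat.leb k m then bernoulli_upto m k
      else - sum_f_R0 (fun j => C (S (S m)) j * bernoulli_upto m j) m
             / INR (S (S m))
  end.

Definition bernoulli (n : nat) : R := bernoulli_upto n n.

Lemma bernoulli_upto_eq (n k : nat) :
  (k <= n)%nat -> bernoulli_upto n k = bernoulli k.
Proof.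
  intros Hk; induction n as [|n IH].
  - now replace k with 0%nat by lia.
  - destruct (Nat.eq_dec k (S n)) as [->|Hne]; [reflexivity|].
    simpl; replace (Nat.leb k n) with true by (symmetry; apply Nat.leb_le; lia).
    apply IH; lia.
Qed.

Lemma bernoulli_0 : bernoulli 0 = 1.
Proof. reflexivity. Qed.

Lemma bernoulli_sum (n : nat) : (1 <= n)%nat ->
  sum_f_R0 (fun k => C (n + 1) k * bernoulli k) n = 0.
Proof.
  destruct n as [|m]; [lia|intros _].
  replace (S m + 1)%nat with (S (S m)) by lia.
  rewrite tech5.
  rewrite (sum_eq _ (fun j => C (S (S m)) j * bernoulli_upto m j) m)
    by (intros i Hi; now rewrite bernoulli_upto_eq).
  assert (HC : C (S (S m)) (S m) = INR (S (S m))).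
  { unfold C; replace (S (S m) - S m)%nat with 1%nat by lia.
    rewrite (fact_simpl (S m)), mult_INR.
    change (INR (fact 1)) with 1.
    field; apply INR_fact_neq_0. }
  rewrite HC; unfold bernoulli at 1.
  assert (HN : INR (S (S m)) <> 0) by (apply not_0_INR; lia).
  cbn [bernoulli_upto].
  replace (Nat.leb (S m) m) with false by (symmetry; apply Nat.leb_gt; lia).
  now field.
Qed.

(* The nonnegative n-th root of x >= 0 (n >= 1).  The case split is needed since
   [Rpower x y] is exp (y * ln x), with ln x = 0 for x <= 0, hence not 0 at
   x = 0. *)
Definition nth_root (n : nat) (x : R) : R :=
  if Rlt_dec 0 x then Rpower x (/ INR n) else 0.

Lemma nth_root_ge0 (n : nat) (x : R) : 0 <= nth_root n x.
Proof.
  unfold nth_root; destruct (Rlt_dec 0 x); [|lra].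
  left; apply exp_pos.
Qed.

Lemma nth_root_pow (n : nat) (x : R) :
  (1 <= n)%nat -> 0 <= x -> nth_root n x ^ n = x.
Proof.
  intros Hn Hx; unfold nth_root; destruct (Rlt_dec 0 x) as [H|H].
  - rewrite <- Rpower_pow by apply exp_pos.
    rewrite Rpower_mult, Rinv_l by (apply not_0_INR; lia).
    now apply Rpower_1.
  - replace x with 0 by lra; apply pow_i; lia.
Qed.

Definition positive_seq (a : nat -> R) : Prop := forall n, 0 < a n.

Definition log_concave (a : nat -> R) : Prop :=
  positive_seq a /\ forall n, a (n + 1)%nat ^ 2 >= a n * a (n + 2)%nat.

Definition log_convex (a : nat -> R) : Prop :=
  positive_seq a /\ forall n, a (n + 1)%nat ^ 2 <= a n * a (n + 2)%nat.

Definition ratio_seq (z : nat -> R) : nat -> R := fun n => z (n + 1)%nat / z n.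

Definition ratio_seq_iter (r : nat) (z : nat -> R) : nat -> R :=
  Nat.iter r ratio_seq z.

Definition tail_seq (N : nat) (a : nat -> R) : nat -> R := fun n => a (N + n)%nat.

Definition almost_infinitely_log_monotonic (z : nat -> R) : Prop :=
  positive_seq z /\
  forall r : nat, exists N : nat,
    (Nat.Even r -> log_convex (tail_seq N (ratio_seq_iter r z))) /\
    (Nat.Odd r -> log_concave (tail_seq N (ratio_seq_iter r z))).

(* Main.v *)
Require Import Defs.
From Stdlib Require Import Reals Lra Lia Arith ClassicalEpsilon.
From Coquelicot Require Import Coquelicot.
Open Scope R_scope.

(** Taking logarithms turns the ratio operator into the forward difference
    [fdiff], so the claim says that the differences of order [r + 2] of
    [h n = ln |B_{2n}| / n] eventually have the sign [(-1)^(r+1)].  They do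
    because [h] behaves like [2 ln n]: the rescaled differences
    [n^(k+1) * fdiff^(k+1) h n] tend to [2 * (-1)^k * k!].  The property of
    having such limits for all [k], with [l] in place of [2], is called
    [log_like l].

    The size of [B_{2n}] comes from Euler's formula in the form
    [|B_{2n}| = 2 (2n)! zeta(2n) / rho^n] ([Rabs_bernoulli_even]).  The value
    of [rho] does not affect the differences of order at least two, so
    [rho = 4 pi^2] is not established and [rho] is just defined as
    [24 zeta(2)].  This allows a proof by strong induction on [n], comparing
    two quadratic recurrences:
    - [bernoulli_even_convolution], from the Riccati equation of
      [x / (e^x - 1)], which is handled as a formal power series;
    - [zeta_even_convolution],
      [sum_{k=1}^{n-1} zeta(2k) zeta(2n-2k) = (n + 1/2) zeta(2n)], from an
      exact identity between finite double sums whose error term involves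
      harmonic numbers and tends to [0].

    By Euler's formula the first difference of [ln |B_{2n}|] is a constant, plus
    two shifted logarithms, plus the difference of [ln zeta(2n)], which is
    exponentially small.  The shifted logarithms are [log_like 1]
    ([log_like_ln]), hence [fdiff (ln |B_{2n}|)] is [log_like 2].
    Finally [log_like_mean] transfers the property from [fdiff a] to
    [a n / n]: the lowest order is a Cesaro mean, and higher orders follow
    from the discrete Leibniz rule applied to [a n = n * (a n / n)]; Stirling's
    formula is therefore never needed. *)

(** * Finite sums *)

Lemma sum_f_R0_rev (f : nat -> R) (n : nat) :
  sum_f_R0 (fun k => f (n - k)%nat) n = sum_f_R0 f n.
Proof.
  revert f; induction n as [|n IH]; intros f; [reflexivity|].
  rewrite decomp_sum, tech5 by lia; cbn [Nat.pred].
  rewrite Nat.sub_0_r, Rplus_comm; f_equal.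
  rewrite <- IH; apply sum_eq; intros; f_equal; lia.
Qed.

Lemma sum_f_R0_triangle (f : nat -> nat -> R) (n : nat) :
  sum_f_R0 (fun i => sum_f_R0 (f i) i) n =
  sum_f_R0 (fun j => sum_f_R0 (fun d => f (j + d)%nat j) (n - j)) n.
Proof.
  induction n as [|n IH]; [reflexivity|].
  rewrite tech5, IH, (tech5 (fun j => sum_f_R0 _ (S n - j))).
  rewrite (sum_eq (fun j => sum_f_R0 _ (S n - j)) (fun j =>
    sum_f_R0 (fun d => f (j + d)%nat j) (n - j) + f (S n) j)).
  - rewrite sum_plus, (tech5 (f (S n))), Nat.sub_diag; cbn [sum_f_R0].
    rewrite Nat.add_0_r; ring.
  - intros j Hj; replace (S n - j)%nat with (S (n - j)) by lia.
    rewrite tech5; do 2 f_equal; lia.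
Qed.

Lemma sum_f_R0_even (f : nat -> R) (m : nat) :
  (forall j, f (S (2 * j)) = 0) ->
  sum_f_R0 f (2 * m) = sum_f_R0 (fun j => f (2 * j)%nat) m.
Proof.
  intros Hf; induction m as [|m IH]; [reflexivity|].
  replace (2 * S m)%nat with (S (S (2 * m))) by lia.
  rewrite !tech5, IH, Hf; replace (2 * S m)%nat with (S (S (2 * m))) by lia; ring.
Qed.

Lemma sum_f_R0_switch (f : nat -> nat -> R) (m n : nat) :
  sum_f_R0 (fun i => sum_f_R0 (f i) n) m =
  sum_f_R0 (fun j => sum_f_R0 (fun i => f i j) m) n.
Proof.
  rewrite <- !sum_n_Reals.
  rewrite (sum_n_ext _ (fun i => sum_n (f i) n)) by (intros; now rewrite sum_n_Reals).
  rewrite sum_n_switch; apply sum_n_ext; intros; apply sum_n_Reals.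
Qed.

Lemma sum_f_R0_mult (f g : nat -> R) (m n : nat) :
  sum_f_R0 f m * sum_f_R0 g n = sum_f_R0 (fun i => sum_f_R0 (fun j => f i * g j) n) m.
Proof.
  rewrite Rmult_comm, scal_sum; apply sum_eq; intros.
  rewrite scal_sum; apply sum_eq; intros; ring.
Qed.

Lemma sum_f_R0_delta (c : nat -> R) (i N : nat) : (i <= N)%nat ->
  sum_f_R0 (fun j => if Nat.eq_dec i j then c j else 0) N = c i.
Proof.
  induction 1 as [|N Hi IH].
  - destruct i; [reflexivity|].
    rewrite tech5, (sum_eq _ (fun _ => 0)), sum_cte.
    + destruct (Nat.eq_dec (S i) (S i)); [ring|easy].
    + intros j Hj; destruct (Nat.eq_dec (S i) j); [lia|easy].
  - rewrite tech5, IH; destruct (Nat.eq_dec i (S N)); [lia|ring].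
Qed.

(** * Cauchy products of formal power series *)

Lemma PS_mult_comm (a b : nat -> R) (n : nat) : PS_mult a b n = PS_mult b a n.
Proof.
  unfold PS_mult; rewrite <- (sum_f_R0_rev (fun k => a k * _)).
  apply sum_eq; intros i Hi; replace (n - (n - i))%nat with i by lia; ring.
Qed.

Lemma PS_mult_ext (a a' b b' : nat -> R) (n : nat) :
  (forall k, a k = a' k) -> (forall k, b k = b' k) ->
  PS_mult a b n = PS_mult a' b' n.
Proof. intros Ha Hb; apply sum_eq; intros; now rewrite Ha, Hb. Qed.

Lemma PS_mult_assoc (a b c : nat -> R) (n : nat) :
  PS_mult (PS_mult a b) c n = PS_mult a (PS_mult b c) n.
Proof.
  unfold PS_mult.
  rewrite (sum_eq _ (fun i => sum_f_R0 (fun j => a j * b (i - j)%nat * c (n - i)%nat) i))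
    by (intros; rewrite Rmult_comm; apply scal_sum).
  rewrite (sum_f_R0_triangle (fun i j => a j * b (i - j)%nat * c (n - i)%nat)).
  apply sum_eq; intros i Hi; rewrite scal_sum; apply sum_eq; intros j Hj.
  replace (i + j - i)%nat with j by lia.
  replace (n - (i + j))%nat with (n - i - j)%nat by lia; ring.
Qed.

Definition PS_one (n : nat) : R := match n with O => 1 | _ => 0 end.
(** The Euler operator [x d/dx], chosen over [d/dx] because its Leibniz rule
    holds term by term without any shift of indices. *)
Definition PS_theta (a : nat -> R) (n : nat) : R := INR n * a n.

Lemma PS_mult_one_r (a : nat -> R) (n : nat) : PS_mult a PS_one n = a n.
Proof.
  unfold PS_mult; destruct n as [|n]; [simpl; ring|].
  rewrite tech5, (sum_eq _ (fun _ => 0)), sum_cte, Nat.sub_diag.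
  - simpl; ring.
  - intros i Hi; replace (S n - i)%nat with (S (n - i)) by lia; simpl; ring.
Qed.

Lemma PS_theta_mult (a b : nat -> R) (n : nat) :
  PS_theta (PS_mult a b) n =
  PS_mult (PS_theta a) b n + PS_mult a (PS_theta b) n.
Proof.
  unfold PS_theta, PS_mult; rewrite <- sum_plus, scal_sum.
  apply sum_eq; intros i Hi; rewrite minus_INR by lia; ring.
Qed.

Lemma PS_mult_incr_1_r (a b : nat -> R) (n : nat) :
  PS_mult a (PS_incr_1 b) n = PS_incr_1 (PS_mult a b) n.
Proof.
  destruct n as [|n]; unfold PS_mult, PS_incr_1; cbn [sum_f_R0 Nat.sub].
  - apply Rmult_0_r.
  - rewrite Nat.sub_diag, (sum_eq _ (fun k => a k * b (n - k)%nat)).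
    + unfold zero; simpl; ring.
    + intros i Hi; destruct i; simpl.
      * now rewrite Nat.sub_0_r.
      * now replace (n - i)%nat with (S (n - S i)) by lia.
Qed.

(** * The quadratic recurrence of the Bernoulli numbers *)

Definition egf_bernoulli (n : nat) : R := bernoulli n / INR (fact n).
(** The coefficients of [(e^x - 1) / x]. *)
Definition exp_quotient (n : nat) : R := / INR (fact (S n)).

(** The defining recurrence of the Bernoulli numbers, divided by [(n+1)!]. *)
Lemma egf_bernoulli_inverse (n : nat) :
  PS_mult egf_bernoulli exp_quotient n = PS_one n.
Proof.
  destruct n as [|n].
  - unfold PS_mult, egf_bernoulli, exp_quotient; simpl; rewrite bernoulli_0; field.
  - unfold PS_mult, egf_bernoulli, exp_quotient, PS_one.
    rewrite <- (Rmult_0_r (/ INR (fact (S n + 1)))), <- (bernoulli_sum (S n)) by lia.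
    rewrite scal_sum; apply sum_eq; intros i Hi.
    unfold Binomial.C; replace (S n + 1 - i)%nat with (S (S n - i)) by lia.
    field; repeat split; apply INR_fact_neq_0.
Qed.

(** With [E = (e^x - 1) / x], differentiate [x E = e^x - 1] and use
    [e^x = 1 + x E]. *)
Lemma exp_quotient_ode (n : nat) :
  PS_theta exp_quotient n =
  PS_one n + PS_incr_1 exp_quotient n - exp_quotient n.
Proof.
  unfold PS_theta, exp_quotient, PS_incr_1, PS_one, zero.
  destruct n as [|n]; [simpl; field|].
  rewrite (fact_simpl (S n)), mult_INR, (S_INR (S n)).
  field; split; [apply INR_fact_neq_0|rewrite <- S_INR; apply not_0_INR; lia].
Qed.

(** Write [b = x / (e^x - 1)], [E = (e^x - 1) / x] and [theta = x d/dx].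
    Since [b E = 1], the Leibniz rule gives
    [(theta b) E = - b (theta E) = 1 - x - b]; multiply by [b]. *)
Lemma egf_bernoulli_riccati (n : nat) :
  PS_mult egf_bernoulli egf_bernoulli n =
  egf_bernoulli n - PS_incr_1 egf_bernoulli n - PS_theta egf_bernoulli n.
Proof.
  assert (HE : forall k, PS_mult (PS_theta egf_bernoulli) exp_quotient k =
    PS_one k - PS_incr_1 PS_one k - egf_bernoulli k).
  { intros k.
    assert (H := PS_theta_mult egf_bernoulli exp_quotient k).
    replace (PS_theta (PS_mult egf_bernoulli exp_quotient) k) with 0 in H
      by (unfold PS_theta; rewrite egf_bernoulli_inverse; destruct k; simpl; ring).
    rewrite (PS_mult_ext egf_bernoulli egf_bernoulli (PS_theta exp_quotient) (fun j =>
      PS_one j + PS_incr_1 exp_quotient j - exp_quotient j)) in H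
      by auto using exp_quotient_ode.
    replace (PS_mult egf_bernoulli (fun j => PS_one j + PS_incr_1 exp_quotient j
      - exp_quotient j) k) with
      (PS_mult egf_bernoulli PS_one k + PS_mult egf_bernoulli (PS_incr_1 exp_quotient) k
       - PS_mult egf_bernoulli exp_quotient k) in H
      by (unfold PS_mult; rewrite <- sum_plus, <- minus_sum;
          apply sum_eq; intros; ring).
    rewrite PS_mult_one_r, PS_mult_incr_1_r, egf_bernoulli_inverse in H.
    replace (PS_incr_1 (PS_mult egf_bernoulli exp_quotient) k) with (PS_incr_1 PS_one k)
      in H by (destruct k; simpl; [reflexivity|now rewrite egf_bernoulli_inverse]).
    lra. }
  assert (H : PS_mult (PS_mult (PS_theta egf_bernoulli) exp_quotient) egf_bernoulli n
    = PS_theta egf_bernoulli n).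
  { rewrite PS_mult_assoc, <- (PS_mult_one_r (PS_theta egf_bernoulli)).
    apply PS_mult_ext; [easy|]; intros k.
    now rewrite PS_mult_comm, egf_bernoulli_inverse. }
  rewrite (PS_mult_ext _ _ egf_bernoulli egf_bernoulli n HE), PS_mult_comm in H
    by auto.
  rewrite <- H.
  replace (PS_mult egf_bernoulli (fun k => PS_one k - PS_incr_1 PS_one k
     - egf_bernoulli k) n) with (PS_mult egf_bernoulli PS_one n
     - PS_mult egf_bernoulli (PS_incr_1 PS_one) n
     - PS_mult egf_bernoulli egf_bernoulli n)
    by (unfold PS_mult; rewrite <- !minus_sum; apply sum_eq; intros; ring).
  rewrite PS_mult_one_r, PS_mult_incr_1_r.
  replace (PS_incr_1 (PS_mult egf_bernoulli PS_one) n) with (PS_incr_1 egf_bernoulli n)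
    by (destruct n; simpl; [reflexivity|now rewrite PS_mult_one_r]).
  ring.
Qed.

(** The coefficients of [x / (e^x - 1) + x / 2], which is an even function:
    dropping [B_1] removes the odd part. *)
Definition even_bernoulli (n : nat) : R :=
  match n with 1%nat => 0 | _ => egf_bernoulli n end.

Lemma egf_bernoulli_1 : egf_bernoulli 1 = - (1 / 2).
Proof.
  unfold egf_bernoulli, bernoulli; simpl; unfold Binomial.C; simpl; field.
Qed.

(** Completing the square with [+ x / 2] turns the term [- x b] of the Riccati
    equation into the single coefficient [x^2 / 4]. *)
Lemma even_bernoulli_riccati (n : nat) :
  PS_mult even_bernoulli even_bernoulli n =
  (1 - INR n) * even_bernoulli n + match n with 2%nat => 1 / 4 | _ => 0 end.
Proof.
  set (x := PS_incr_1 PS_one : nat -> R).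
  assert (HA : forall k, even_bernoulli k = egf_bernoulli k + / 2 * x k).
  { intros [|[|k]]; unfold x, zero; simpl; unfold zero; simpl; try ring.
    rewrite egf_bernoulli_1; field. }
  rewrite (PS_mult_ext _ _ _ _ n HA HA).
  replace (PS_mult _ _ n) with
    (PS_mult egf_bernoulli egf_bernoulli n + PS_mult egf_bernoulli x n
     + / 4 * PS_mult x x n).
  2: { transitivity (PS_mult egf_bernoulli egf_bernoulli n +
         / 2 * PS_mult egf_bernoulli x n + / 2 * PS_mult x egf_bernoulli n
         + / 4 * PS_mult x x n).
       - rewrite (PS_mult_comm x egf_bernoulli); field.
       - unfold PS_mult; rewrite !scal_sum, <- !sum_plus; apply sum_eq.
         intros; field. }
  unfold x; rewrite egf_bernoulli_riccati, !PS_mult_incr_1_r, HA.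
  unfold PS_theta, x.
  destruct n as [|[|[|n]]]; unfold PS_incr_1, zero; simpl AbelianMonoid.zero;
    rewrite ?PS_mult_one_r; simpl PS_one; unfold zero; simpl; try field.
Qed.

(** In the recurrence at an odd index every product has a factor of odd index,
    and all these factors but the two extreme ones vanish by induction. *)
Lemma even_bernoulli_odd (m : nat) : even_bernoulli (S (2 * m)) = 0.
Proof.
  induction m as [m IH] using lt_wf_ind.
  destruct m as [|m]; [reflexivity|].
  assert (H := even_bernoulli_riccati (S (2 * S m))).
  unfold PS_mult in H; rewrite decomp_sum, Nat.sub_0_r in H by lia.
  cbn [Nat.pred] in H; replace (2 * S m)%nat with (S (S (2 * m))) in * by lia.
  rewrite tech5, Nat.sub_diag, (sum_eq _ (fun _ => 0)), sum_cte in H.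
  - replace (even_bernoulli 0) with 1 in H
      by (unfold even_bernoulli, egf_bernoulli; rewrite bernoulli_0; simpl; field).
    (* The two extreme terms add [2 b_n] to the left side, giving [(n + 1) b_n = 0]. *)
    assert (0 <= INR (S (S (S (2 * m))))) by apply pos_INR.
    nra.
  - intros i Hi; destruct (Nat.Even_or_Odd i) as [[j ->]|[j ->]].
    + rewrite IH by lia; ring.
    + replace (S (S (S (2 * m))) - S (2 * j + 1))%nat with (S (2 * (m - j))) by lia.
      rewrite (IH (m - j)%nat) by lia; ring.
Qed.

(** Euler's recurrence
    [sum_{0<i<n} b_{2i} b_{2n-2i} = - (2n+1) b_{2n}], [b_j = B_j / j!], for
    [n = m + 2]; the shift of the indices makes it a Cauchy product. *)
Lemma bernoulli_even_convolution (m : nat) :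
  let q := fun i => egf_bernoulli (2 * S i) in
  PS_mult q q m = - INR (2 * m + 5) * q (S m).
Proof.
  intros q.
  assert (H := even_bernoulli_riccati (2 * S (S m))).
  unfold PS_mult in H; rewrite sum_f_R0_even in H
    by (intros; rewrite even_bernoulli_odd; ring).
  rewrite decomp_sum, Nat.mul_0_r, Nat.sub_0_r in H by lia; cbn [Nat.pred] in H.
  rewrite tech5, Nat.sub_diag in H.
  replace (even_bernoulli 0) with 1 in H
    by (unfold even_bernoulli, egf_bernoulli; rewrite bernoulli_0; simpl; field).
  replace (even_bernoulli (2 * S (S m))) with (q (S m)) in H
    by (unfold q; replace (2 * S (S m))%nat with (S (S (S (S (2 * m))))) by lia; reflexivity).
  replace (match (2 * S (S m))%nat with 2%nat => 1 / 4 | _ => 0 end) with 0 in H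
    by (replace (2 * S (S m))%nat with (S (S (S (S (2 * m))))) by lia; reflexivity).
  rewrite (sum_eq _ (fun i => q i * q (m - i)%nat)) in H.
  - unfold PS_mult; rewrite mult_INR, !S_INR in H; rewrite plus_INR, mult_INR.
    simpl in *; lra.
  - intros i Hi; unfold q.
    replace (2 * S (S m) - 2 * S i)%nat with (2 * S (m - i))%nat by lia.
    f_equal; [replace (2 * S i)%nat with (S (S (2 * i))) by lia
      |replace (2 * S (m - i))%nat with (S (S (2 * (m - i)))) by lia]; reflexivity.
Qed.

Lemma egf_bernoulli_2 : egf_bernoulli 2 = / 12.
Proof.
  unfold egf_bernoulli, bernoulli; simpl; unfold Binomial.C; simpl; field.
Qed.

(** * Limits of sequences *)

Lemma is_lim_seq_cesaro (e : nat -> R) (l : R) :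
  is_lim_seq (fun n => e (S n) - e n) l ->
  is_lim_seq (fun n => e n / INR (S n)) l.
Proof.
  intros H.
  set (d := fun i => match i with O => e 0%nat | S j => e (S j) - e j end).
  assert (Hd : forall n, sum_f_R0 d n = e n).
  { induction n as [|n IH]; [reflexivity|]; rewrite tech5, IH; simpl; ring. }
  assert (HC : Un_cv (fun n => sum_f_R0 d (Nat.pred n) / INR n) l).
  { apply Cesaro_1, is_lim_seq_Reals, is_lim_seq_incr_1; exact H. }
  apply is_lim_seq_Reals, is_lim_seq_incr_1 in HC.
  revert HC; apply is_lim_seq_ext; intros n; now rewrite Hd.
Qed.

Lemma is_lim_seq_inv_INR : is_lim_seq (fun n => / INR (S n)) 0.
Proof.
  apply (is_lim_seq_inv _ p_infty); [|easy].
  apply -> (is_lim_seq_incr_1 INR); apply is_lim_seq_INR.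
Qed.

Lemma is_lim_seq_sum_f_R0 (u : nat -> nat -> R) (l : nat -> R) (m : nat) :
  (forall k, (k <= m)%nat -> is_lim_seq (u k) (l k)) ->
  is_lim_seq (fun N => sum_f_R0 (fun k => u k N) m) (sum_f_R0 l m).
Proof.
  induction m as [|m IH]; intros H.
  - apply H; lia.
  - cbn [sum_f_R0]; apply is_lim_seq_plus'; [apply IH; intros|]; apply H; lia.
Qed.

Lemma is_lim_seq_ratio_one (w : nat -> R) (M : R) :
  (forall n, 0 < w n) -> (forall n, Rabs (w n - INR (S n)) <= M) ->
  is_lim_seq (fun n => w n / INR (S n)) 1 /\ is_lim_seq (fun n => INR (S n) / w n) 1.
Proof.
  intros Hw HM.
  assert (H : is_lim_seq (fun n => w n / INR (S n)) 1).
  { apply (is_lim_seq_le_le (fun n => 1 - M * / INR (S n)) _ (fun n => 1 + M * / INR (S n))).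
    - intros n; assert (Hn := HM n); apply Rabs_le_between in Hn.
      assert (Hp : 0 < INR (S n)) by (apply lt_0_INR; lia).
      replace (w n / INR (S n)) with (1 + (w n - INR (S n)) * / INR (S n)) by (field; lra).
      assert (Hi := Rinv_0_lt_compat _ Hp); split; nra.
    - replace (Finite 1) with (Finite (1 - M * 0)) by (f_equal; ring).
      apply is_lim_seq_minus'; [apply is_lim_seq_const|].
      apply is_lim_seq_mult'; [apply is_lim_seq_const|apply is_lim_seq_inv_INR].
    - replace (Finite 1) with (Finite (1 + M * 0)) by (f_equal; ring).
      apply is_lim_seq_plus'; [apply is_lim_seq_const|].
      apply is_lim_seq_mult'; [apply is_lim_seq_const|apply is_lim_seq_inv_INR]. }
  split; [exact H|].
  apply (is_lim_seq_ext (fun n => / (w n / INR (S n)))).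
  - intros n; specialize (Hw n).
    assert (0 < INR (S n)) by (apply lt_0_INR; lia); field; lra.
  - replace (Finite 1) with (Rbar_inv 1) by (simpl; f_equal; field).
    apply is_lim_seq_inv; [exact H|]; intros E; injection E; lra.
Qed.

Lemma pow_mult_geom_lim (k : nat) : is_lim_seq (fun n => INR (S n) ^ k * (/ 4) ^ n) 0.
Proof.
  assert (Hp : forall n, 0 < INR (S n)) by (intros; apply lt_0_INR; lia).
  assert (Hq : forall n, 0 < (/ 4) ^ n) by (intros; apply pow_lt; lra).
  assert (Ht : forall n, 0 < INR (S n) ^ k * (/ 4) ^ n)
    by (intros n; apply Rmult_lt_0_compat; [apply pow_lt, Hp|apply Hq]).
  apply ex_series_lim_0, ex_series_Rabs, (ex_series_DAlembert _ (/ 4)); [lra| |].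
  - intros n; apply Rgt_not_eq, Ht.
  - apply (is_lim_seq_ext (fun n => (INR (S (S n)) / INR (S n)) ^ k * / 4)).
    + intros n; rewrite Rabs_pos_eq.
      * unfold Rdiv; rewrite Rpow_mult_distr, (pow_inv (INR (S n))); cbn [pow].
        assert (H1 := Hq n); assert (H2 := pow_lt _ k (Hp n)); field; lra.
      * apply Rlt_le, Rdiv_lt_0_compat; apply Ht.
    + replace (Finite (/ 4)) with (Finite (1 ^ k * / 4)) by (f_equal; rewrite pow1; ring).
      apply is_lim_seq_mult'; [|apply is_lim_seq_const].
      clear Ht; induction k as [|k IH]; [apply is_lim_seq_const|].
      cbn [pow]; apply is_lim_seq_mult'; [|exact IH].
      apply (is_lim_seq_ratio_one (fun n => INR (S (S n))) 1); intros n; [apply Hp|].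
      rewrite (S_INR (S n)); apply Rabs_le; lra.
Qed.

(** * The quadratic recurrence of the even zeta values *)

Fixpoint harmonic (n : nat) : R :=
  match n with O => 0 | S m => harmonic m + / INR n end.

Definition inv_sq (i : nat) : R := / INR (S i) ^ 2.
(** A partial sum of [zeta(2k+2)]: [inv_sq i] is [1 / a^2] for [a = i + 1]. *)
Definition zeta_partial (k N : nat) : R := sum_f_R0 (fun i => inv_sq i ^ S k) N.

Definition sq_gap_inv (i j : nat) : R :=
  if Nat.eq_dec i j then 0 else / (INR (S j) ^ 2 - INR (S i) ^ 2).

(** Partial fractions, as long as the diagonal is not reached:
    [1 / (b^2 - a^2) = - (1 / (a - b) + 1 / (a + b)) / (2 a)]. *)
Lemma sum_sq_gap_inv_below (i M : nat) : (M < i)%nat ->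
  sum_f_R0 (sq_gap_inv i) M =
  - (harmonic i - harmonic (i - S M) + harmonic (i + S (S M)) - harmonic (S i))
    / (2 * INR (S i)).
Proof.
  induction M as [|M IH]; intros HM.
  - cbn [sum_f_R0]; unfold sq_gap_inv; destruct (Nat.eq_dec i 0); [lia|].
    destruct i as [|i]; [lia|].
    replace (S i - 1)%nat with i by lia.
    replace (S i + 2)%nat with (S (S (S i))) by lia; cbn [harmonic].
    rewrite !S_INR; assert (0 <= INR i) by apply pos_INR; simpl INR.
    field; repeat split; nra.
  - rewrite tech5, IH by lia.
    unfold sq_gap_inv; destruct (Nat.eq_dec i (S M)); [lia|].
    replace (i - S M)%nat with (S (i - S (S M))) by lia.
    replace (i + S (S (S M)))%nat with (S (i + S (S M))) by lia; cbn [harmonic].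
    rewrite !S_INR, minus_INR, plus_INR, !S_INR by lia.
    assert (0 <= INR M) by apply pos_INR.
    assert (INR (S M) < INR i) by (apply lt_INR; lia); rewrite S_INR in *.
    field; repeat split; nra.
Qed.

(** Past the diagonal the sum telescopes further.  The terms missing from the
    harmonic sums, [1 / a] and the diagonal [1 / (2 a)], produce [3 / (4 a^2)];
    the gap between the two harmonic numbers tends to [0] for [N] large. *)
Lemma sum_sq_gap_inv (i N : nat) : (i <= N)%nat ->
  sum_f_R0 (sq_gap_inv i) N =
  3 / 4 * inv_sq i - (harmonic (S N + S i) - harmonic (N - i)) / (2 * INR (S i)).
Proof.
  intros Hi; induction Hi as [|N Hi IH].
  - destruct i as [|i].
    + cbn [sum_f_R0]; unfold sq_gap_inv; simpl; unfold inv_sq; simpl; field.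
    + assert (0 <= INR i) by apply pos_INR.
      rewrite tech5, sum_sq_gap_inv_below by lia.
      unfold sq_gap_inv; destruct (Nat.eq_dec (S i) (S i)); [|easy].
      rewrite !Nat.sub_diag.
      replace (S (S i) + S (S i))%nat with (S (S i + S (S i))) by lia.
      cbn [harmonic]; unfold inv_sq.
      rewrite !S_INR, plus_INR, !S_INR.
      field; repeat split; nra.
  - rewrite tech5, IH.
    unfold sq_gap_inv; destruct (Nat.eq_dec i (S N)); [lia|].
    replace (S N - i)%nat with (S (N - i)) by lia.
    replace (S (S N) + S i)%nat with (S (S N + S i)) by lia; cbn [harmonic].
    rewrite !S_INR, minus_INR, plus_INR, !S_INR by lia.
    assert (0 <= INR i) by apply pos_INR.
    assert (INR i <= INR N) by (apply le_INR; lia).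
    field; repeat split; nra.
Qed.

Lemma sum_pow_conv (u v : R) (m : nat) :
  (u - v) * sum_f_R0 (fun k => u ^ S k * v ^ S (m - k)) m =
  u * v * (u ^ S m - v ^ S m).
Proof.
  induction m as [|m IH]; [simpl; ring|].
  rewrite tech5, Nat.sub_diag, (sum_eq _ (fun k => u ^ S k * v ^ S (m - k) * v)).
  - rewrite <- scal_sum, Rmult_plus_distr_l, <- Rmult_assoc, (Rmult_comm _ v),
      Rmult_assoc, IH; simpl; ring.
  - intros k Hk; replace (S m - k)%nat with (S (m - k)) by lia; simpl; ring.
Qed.

Lemma inv_sq_pos (i : nat) : 0 < inv_sq i.
Proof. apply Rinv_0_lt_compat, pow_lt, lt_0_INR; lia. Qed.

(** The geometric sum is divided by [u - v], where
    [u v / (u - v) = 1 / (b^2 - a^2)] for [u = 1 / a^2] and [v = 1 / b^2]. *)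
Lemma inv_sq_conv (i j m : nat) :
  sum_f_R0 (fun k => inv_sq i ^ S k * inv_sq j ^ S (m - k)) m =
  (if Nat.eq_dec i j then INR (S m) * inv_sq i ^ S (S m) else 0)
  + inv_sq i ^ S m * sq_gap_inv i j + inv_sq j ^ S m * sq_gap_inv j i.
Proof.
  unfold sq_gap_inv; destruct (Nat.eq_dec i j) as [<-|Hij].
  - destruct (Nat.eq_dec i i); [|easy].
    rewrite (sum_eq _ (fun _ => inv_sq i ^ S (S m))), sum_cte; [ring|].
    intros k Hk; rewrite <- pow_add; f_equal; lia.
  - destruct (Nat.eq_dec j i); [now symmetry in e|].
    assert (Hd : INR (S j) ^ 2 - INR (S i) ^ 2 <> 0).
    { assert (0 <= INR i) by apply pos_INR; assert (0 <= INR j) by apply pos_INR.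
      assert (INR i <> INR j) by now apply not_INR.
      rewrite !S_INR; intros E; nra. }
    assert (INR (S i) <> 0) by (apply not_0_INR; lia).
    assert (INR (S j) <> 0) by (apply not_0_INR; lia).
    apply (Rmult_eq_reg_l (inv_sq i - inv_sq j)).
    + rewrite sum_pow_conv; set (U := inv_sq i ^ S m); set (V := inv_sq j ^ S m).
      unfold inv_sq; field; repeat split; auto; lra.
    + unfold inv_sq; replace (_ - _) with
        ((INR (S j) ^ 2 - INR (S i) ^ 2) * (inv_sq i * inv_sq j))
        by (unfold inv_sq; field; auto).
      apply Rmult_integral_contrapositive; split; [easy|].
      apply Rgt_not_eq, Rmult_gt_0_compat; apply inv_sq_pos.
Qed.

(** The error made when [zeta] is replaced by its partial sums in the
    quadratic recurrence. *)
Definition conv_defect (m N : nat) : R :=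
  sum_f_R0 (fun i => inv_sq i ^ S m *
    ((harmonic (S N + S i) - harmonic (N - i)) / INR (S i))) N.

(** Expand the products into a double sum over [a] and [b].  The diagonal
    gives [(m + 1)] times the partial sum; the other terms are symmetric in
    [a] and [b], and summing over [b] first gives a further [2 * 3 / 4], up to
    the harmonic terms collected in [conv_defect]. *)
Lemma zeta_partial_conv (m N : nat) :
  PS_mult (fun k => zeta_partial k N) (fun k => zeta_partial k N) m =
  (INR m + 5 / 2) * zeta_partial (S m) N - conv_defect m N.
Proof.
  unfold PS_mult, zeta_partial.
  rewrite (sum_eq _ (fun k => sum_f_R0 (fun i => sum_f_R0 (fun j =>
    inv_sq i ^ S k * inv_sq j ^ S (m - k)) N) N))
    by (intros; apply sum_f_R0_mult).
  rewrite sum_f_R0_switch.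
  rewrite (sum_eq _ (fun i => sum_f_R0 (fun j => sum_f_R0 (fun k =>
    inv_sq i ^ S k * inv_sq j ^ S (m - k)) m) N))
    by (intros; apply sum_f_R0_switch).
  rewrite (sum_eq _ (fun i => INR (S m) * inv_sq i ^ S (S m)
    + sum_f_R0 (fun j => inv_sq i ^ S m * sq_gap_inv i j) N
    + sum_f_R0 (fun j => inv_sq j ^ S m * sq_gap_inv j i) N)).
  2: { intros i Hi; rewrite <- (sum_f_R0_delta (fun j => INR (S m) * inv_sq i ^ S (S m)) i N Hi).
       rewrite <- !sum_plus; apply sum_eq; intros j Hj; apply inv_sq_conv. }
  rewrite !sum_plus, (sum_f_R0_switch (fun i j => inv_sq j ^ S m * sq_gap_inv j i)).
  unfold conv_defect; rewrite scal_sum, <- minus_sum, <- !sum_plus.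
  apply sum_eq; intros i Hi.
  rewrite (sum_eq _ (fun j => sq_gap_inv i j * inv_sq i ^ S m)) by (intros; ring).
  rewrite <- scal_sum, sum_sq_gap_inv by easy.
  rewrite (S_INR m); cbn [pow]; field.
  apply not_0_INR; lia.
Qed.

Lemma harmonic_gap (M d : nat) :
  0 <= harmonic (M + d) - harmonic M <= INR d / INR (S M).
Proof.
  induction d as [|d IH].
  - rewrite Nat.add_0_r; simpl; lra.
  - replace (M + S d)%nat with (S (M + d)) by lia; cbn [harmonic].
    assert (0 < / INR (S (M + d))) by (apply Rinv_0_lt_compat, lt_0_INR; lia).
    assert (/ INR (S (M + d)) <= / INR (S M))
      by (apply Rinv_le_contravar; [apply lt_0_INR|apply le_INR]; lia).
    rewrite (S_INR d); unfold Rdiv in *; lra.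
Qed.

Lemma harmonic_sum (N : nat) : harmonic (S N) = sum_f_R0 (fun i => / INR (S i)) N.
Proof.
  induction N as [|N IH]; [simpl; ring|].
  rewrite tech5, <- IH; reflexivity.
Qed.

Lemma inv_sq_le_1 (i : nat) : inv_sq i <= 1.
Proof.
  unfold inv_sq; rewrite <- Rinv_1; apply Rinv_le_contravar; [lra|].
  rewrite S_INR; assert (0 <= INR i) by apply pos_INR; nra.
Qed.

(** With [a = i + 1], the harmonic gap is at most [2 a / (N + 2 - a)], and
    [a (N + 2 - a) >= N + 1], so the defect is at most twice the Cesaro mean of
    [1 / a]. *)
Lemma conv_defect_lim (m : nat) : is_lim_seq (conv_defect m) 0.
Proof.
  apply (is_lim_seq_le_le (fun _ => 0) _ (fun N => 2 * (harmonic (S N) / INR (S N)))).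
  - intros N; unfold conv_defect; split.
    + apply cond_pos_sum; intros i; apply Rmult_le_pos.
      * apply pow_le, Rlt_le, inv_sq_pos.
      * apply Rmult_le_pos; [|apply Rlt_le, Rinv_0_lt_compat, lt_0_INR; lia].
        replace (S N + S i)%nat with (N - i + (S N + S i - (N - i)))%nat by lia.
        apply harmonic_gap.
    + rewrite harmonic_sum; unfold Rdiv; rewrite (Rmult_comm (sum_f_R0 _ _)), <- Rmult_assoc,
        scal_sum.
      apply sum_Rle; intros i Hi.
      assert (Hp : 0 < INR (S i)) by (apply lt_0_INR; lia).
      assert (HM : 0 < INR (S (N - i))) by (apply lt_0_INR; lia).
      assert (HN : 0 < INR (S N)) by (apply lt_0_INR; lia).
      destruct (harmonic_gap (N - i) (2 * S i)) as [Hg0 Hg].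
      replace (N - i + 2 * S i)%nat with (S N + S i)%nat in * by lia.
      set (g := harmonic (S N + S i) - harmonic (N - i)) in *.
      assert (Hu : inv_sq i ^ S m <= inv_sq i).
      { rewrite <- (Rmult_1_r (inv_sq i)) at 2; cbn [pow].
        apply Rmult_le_compat_l; [apply Rlt_le, inv_sq_pos|].
        rewrite <- (pow1 m); apply pow_incr; split;
          [apply Rlt_le, inv_sq_pos|apply inv_sq_le_1]. }
      apply Rle_trans with (inv_sq i * (INR (2 * S i) / INR (S (N - i)) * / INR (S i))).
      * apply Rmult_le_compat; trivial.
        -- apply pow_le, Rlt_le, inv_sq_pos.
        -- apply Rmult_le_pos; [easy|apply Rlt_le, Rinv_0_lt_compat, Hp].
        -- apply Rmult_le_compat_r; [apply Rlt_le, Rinv_0_lt_compat, Hp|easy].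
      * unfold inv_sq; rewrite mult_INR.
        replace (INR 2) with 2 by (simpl; ring).
        replace (/ INR (S i) ^ 2 * _) with
          (/ INR (S i) * (2 * / (INR (S i) * INR (S (N - i)))))
          by (field; lra).
        apply Rmult_le_compat_l; [apply Rlt_le, Rinv_0_lt_compat, Hp|].
        apply Rmult_le_compat_l; [lra|].
        apply Rinv_le_contravar; [easy|].
        rewrite <- mult_INR; apply le_INR; nia.
  - apply is_lim_seq_const.
  - replace (Finite 0) with (Rbar_mult 2 0) by (simpl; f_equal; ring).
    apply is_lim_seq_scal_l, (is_lim_seq_cesaro (fun N => harmonic (S N))).
    apply (is_lim_seq_ext (fun n => / INR (S (S n)))).
    + intros n; cbn [harmonic]; ring.
    + apply -> (is_lim_seq_incr_1 (fun n => / INR (S n))); apply is_lim_seq_inv_INR.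
Qed.

(** For [a >= 2], [a^(-2(k+1)) <= 4^(-k) a^(-2)], and [a^(-2)] is dominated by
    the telescoping [1 / (a - 1) - 1 / a]. *)
Lemma zeta_partial_bound (k N : nat) :
  zeta_partial k N <= 1 + (/ 4) ^ k * (1 - / INR (S N)).
Proof.
  unfold zeta_partial; induction N as [|N IH].
  - cbn [sum_f_R0]; unfold inv_sq; simpl INR; rewrite pow1, Rinv_1, pow1; lra.
  - rewrite tech5.
    assert (H : inv_sq (S N) ^ S k <= (/ 4) ^ k * (/ INR (S N) - / INR (S (S N)))).
    { cbn [pow]; rewrite Rmult_comm; assert (0 <= INR N) by apply pos_INR.
      apply Rmult_le_compat.
      - apply pow_le, Rlt_le, inv_sq_pos.
      - apply Rlt_le, inv_sq_pos.
      - apply pow_incr; split; [apply Rlt_le, inv_sq_pos|].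
        apply Rinv_le_contravar; [lra|]; rewrite !S_INR; nra.
      - unfold inv_sq; rewrite !S_INR.
        replace (/ (INR N + 1) - / (INR N + 1 + 1)) with
          (/ ((INR N + 1) * (INR N + 1 + 1))) by (field; lra).
        apply Rinv_le_contravar; nra. }
    lra.
Qed.

(** This is [zeta(2k+2)]. *)
Definition zeta_even (k : nat) : R := real (Lim_seq (zeta_partial k)).

Lemma zeta_partial_incr (k N : nat) : zeta_partial k N <= zeta_partial k (S N).
Proof.
  unfold zeta_partial; rewrite tech5.
  assert (0 <= inv_sq (S N) ^ S k) by apply pow_le, Rlt_le, inv_sq_pos; lra.
Qed.

Lemma zeta_even_lim (k : nat) : is_lim_seq (zeta_partial k) (zeta_even k).
Proof.
  apply Lim_seq_correct', (ex_finite_lim_seq_incr _ (1 + (/ 4) ^ k)).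
  - apply zeta_partial_incr.
  - intros N; apply (Rle_trans _ _ _ (zeta_partial_bound k N)).
    assert (0 < (/ 4) ^ k) by (apply pow_lt; lra).
    assert (0 < / INR (S N)) by (apply Rinv_0_lt_compat, lt_0_INR; lia).
    nra.
Qed.

Lemma zeta_even_bounds (k : nat) : 1 <= zeta_even k <= 1 + (/ 4) ^ k.
Proof.
  split.
  - assert (H := is_lim_seq_incr_compare _ _ (zeta_even_lim k) (zeta_partial_incr k) 0%nat).
    revert H; unfold zeta_partial, inv_sq; cbn [sum_f_R0]; simpl INR.
    now rewrite pow1, Rinv_1, pow1.
  - apply (is_lim_seq_le (zeta_partial k) (fun _ => 1 + (/ 4) ^ k)
      (zeta_even k) (1 + (/ 4) ^ k)).
    + intros N; apply (Rle_trans _ _ _ (zeta_partial_bound k N)).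
      assert (0 < (/ 4) ^ k) by (apply pow_lt; lra).
      assert (0 < / INR (S N)) by (apply Rinv_0_lt_compat, lt_0_INR; lia).
      nra.
    + apply zeta_even_lim.
    + apply is_lim_seq_const.
Qed.

Lemma zeta_even_convolution (m : nat) :
  PS_mult zeta_even zeta_even m = (INR m + 5 / 2) * zeta_even (S m).
Proof.
  assert (H1 : is_lim_seq (fun N => PS_mult (fun k => zeta_partial k N)
    (fun k => zeta_partial k N) m) (PS_mult zeta_even zeta_even m)).
  { apply (is_lim_seq_sum_f_R0
      (fun k N => zeta_partial k N * zeta_partial (m - k) N)
      (fun k => zeta_even k * zeta_even (m - k)%nat)).
    intros k _; apply is_lim_seq_mult'; apply zeta_even_lim. }
  assert (H2 : is_lim_seq (fun N => PS_mult (fun k => zeta_partial k N)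
    (fun k => zeta_partial k N) m) ((INR m + 5 / 2) * zeta_even (S m) - 0)).
  { apply (is_lim_seq_ext (fun N =>
      (INR m + 5 / 2) * zeta_partial (S m) N - conv_defect m N)).
    - intros N; symmetry; apply zeta_partial_conv.
    - apply is_lim_seq_minus'; [|apply conv_defect_lim].
      apply is_lim_seq_mult'; [apply is_lim_seq_const|apply zeta_even_lim]. }
  assert (E := is_lim_seq_unique _ _ H1); rewrite (is_lim_seq_unique _ _ H2) in E.
  injection E; lra.
Qed.

(** * Euler's formula up to the value of the constant *)

(** This is [4 pi^2]; the definition is the one that makes Euler's formula
    correct for [B_2]. *)
Definition rho : R := 24 * zeta_even 0.

Lemma rho_pos : 0 < rho.
Proof. unfold rho; assert (H := zeta_even_bounds 0); lra. Qed.

(** Both sides satisfy the same quadratic recurrence, and the sign [(-1)^n]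
    accounts for its minus sign. *)
Lemma egf_bernoulli_even (n : nat) :
  egf_bernoulli (2 * S n) = (-1) ^ n * (2 * zeta_even n / rho ^ S n).
Proof.
  assert (Hr := rho_pos).
  induction n as [n IH] using lt_wf_ind.
  destruct n as [|m].
  - replace (2 * 1)%nat with 2%nat by lia; rewrite egf_bernoulli_2.
    simpl; unfold rho in *; field; lra.
  - assert (H := bernoulli_even_convolution m); cbv zeta in H.
    unfold PS_mult in H.
    rewrite (sum_eq _ (fun k => zeta_even k * zeta_even (m - k)
      * ((-1) ^ m * 4 / rho ^ S (S m)))) in H.
    + rewrite <- scal_sum in H; fold (PS_mult zeta_even zeta_even m) in H.
      rewrite zeta_even_convolution in H.
      assert (Hm : 0 < INR (2 * m + 5)) by (apply lt_0_INR; lia).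
      apply (Rmult_eq_reg_l (INR (2 * m + 5))); [|lra].
      replace (INR (2 * m + 5) * egf_bernoulli (2 * S (S m))) with
        (- (- INR (2 * m + 5) * egf_bernoulli (2 * S (S m)))) by ring.
      rewrite <- H.
      replace (INR (2 * m + 5)) with (2 * (INR m + 5 / 2))
        by (rewrite plus_INR, mult_INR; simpl; field).
      simpl; field; repeat split; try apply pow_nonzero; lra.
    + intros k Hk; rewrite !IH by lia.
      replace ((-1) ^ m) with ((-1) ^ k * (-1) ^ (m - k))
        by (rewrite <- pow_add; f_equal; lia).
      replace (rho ^ S (S m)) with (rho ^ S k * rho ^ S (m - k))
        by (rewrite <- pow_add; f_equal; lia).
      field; split; apply pow_nonzero; lra.
Qed.

Lemma Rabs_bernoulli_even (n : nat) :
  Rabs (bernoulli (2 * S n)) =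
  2 * INR (fact (2 * S n)) * zeta_even n / rho ^ S n.
Proof.
  assert (Hf := INR_fact_lt_0 (2 * S n)).
  assert (Hr := pow_lt _ (S n) rho_pos).
  assert (Hz := zeta_even_bounds n).
  replace (bernoulli (2 * S n)) with (egf_bernoulli (2 * S n) * INR (fact (2 * S n)))
    by (unfold egf_bernoulli; field; lra).
  rewrite egf_bernoulli_even, !Rabs_mult, pow_1_abs.
  rewrite (Rabs_pos_eq (INR _)) by lra.
  rewrite Rabs_pos_eq.
  - field; lra.
  - apply Rmult_le_pos; [lra|apply Rlt_le, Rinv_0_lt_compat, Hr].
Qed.

(** * Finite differences of logarithmic sequences *)

Definition fdiff (u : nat -> R) (n : nat) : R := u (S n) - u n.
Notation fdiffs k := (Nat.iter k fdiff).

Lemma fdiffs_ext (k : nat) (u v : nat -> R) (n : nat) :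
  (forall m, u m = v m) -> fdiffs k u n = fdiffs k v n.
Proof.
  intros H; revert n; induction k as [|k IH]; intros n; simpl; [apply H|].
  unfold fdiff at 1 3; now rewrite !IH.
Qed.

Lemma fdiffs_plus (k : nat) (u v : nat -> R) (n : nat) :
  fdiffs k (fun m => u m + v m) n = fdiffs k u n + fdiffs k v n.
Proof.
  revert n; induction k as [|k IH]; intros n; simpl; [reflexivity|].
  unfold fdiff at 1 3 5; rewrite !IH; ring.
Qed.

Lemma fdiffs_opp (k : nat) (u : nat -> R) (n : nat) :
  fdiffs k (fun m => - u m) n = - fdiffs k u n.
Proof.
  revert n; induction k as [|k IH]; intros n; simpl; [reflexivity|].
  unfold fdiff at 1 3; rewrite !IH; ring.
Qed.

Lemma fdiffs_const (k : nat) (c : R) (n : nat) : fdiffs (S k) (fun _ => c) n = 0.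
Proof.
  revert n; induction k as [|k IH]; intros n.
  - simpl; unfold fdiff; ring.
  - change (fdiff (fdiffs (S k) (fun _ => c)) n = 0); unfold fdiff; rewrite !IH; ring.
Qed.

Lemma fdiffs_shift (k : nat) (u : nat -> R) (n : nat) :
  fdiffs k (fun m => u (S m)) n = fdiffs k u (S n).
Proof.
  revert n; induction k as [|k IH]; intros n; simpl; [reflexivity|].
  unfold fdiff at 1 3; now rewrite !IH.
Qed.

(** The product rule for a factor [w] of slope [1].  Evaluating all terms at
    the same [n] moves the shift of the usual rule into the factor
    [w n + (k + 1)]. *)
Lemma fdiffs_leibniz (w u : nat -> R) (k n : nat) :
  (forall m, w (S m) = w m + 1) ->
  fdiffs (S k) (fun m => w m * u m) n =
  (w n + INR (S k)) * fdiffs (S k) u n + INR (S k) * fdiffs k u n.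
Proof.
  intros Hw; revert n; induction k as [|k IH]; intros n.
  - simpl; unfold fdiff; rewrite Hw; ring.
  - change (fdiffs (S (S k)) (fun m => w m * u m) n) with
      (fdiff (fdiffs (S k) (fun m => w m * u m)) n).
    unfold fdiff at 1; rewrite !IH, Hw.
    change (fdiffs (S (S k)) u n) with (fdiffs (S k) u (S n) - fdiffs (S k) u n).
    change (fdiffs (S k) u n) with (fdiffs k u (S n) - fdiffs k u n).
    rewrite (S_INR (S k)); ring.
Qed.

(** The limits are those of [l * ln n], whose derivative of order [k + 1] is
    [l * (-1)^k * k! / n^(k+1)]; the variable is [S n] so that it never
    vanishes. *)
Definition log_like (l : R) (u : nat -> R) : Prop :=
  forall k, is_lim_seq (fun n => INR (S n) ^ S k * fdiffs (S k) u n)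
    (l * ((-1) ^ k * INR (fact k))).

Lemma log_like_ext (l : R) (u v : nat -> R) :
  (forall n, u n = v n) -> log_like l u -> log_like l v.
Proof.
  intros E H k; apply (is_lim_seq_ext (fun n => INR (S n) ^ S k * fdiffs (S k) u n));
    [|apply H]; intros n; f_equal; now apply fdiffs_ext.
Qed.

Lemma log_like_plus (l1 l2 : R) (u v : nat -> R) :
  log_like l1 u -> log_like l2 v -> log_like (l1 + l2) (fun n => u n + v n).
Proof.
  intros Hu Hv k.
  apply (is_lim_seq_ext (fun n => INR (S n) ^ S k * fdiffs (S k) u n
    + INR (S n) ^ S k * fdiffs (S k) v n)).
  - intros n; rewrite fdiffs_plus; ring.
  - rewrite Rmult_plus_distr_r; apply is_lim_seq_plus'; [apply Hu|apply Hv].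
Qed.

Lemma log_like_const (c : R) : log_like 0 (fun _ => c).
Proof.
  intros k; rewrite Rmult_0_l; apply (is_lim_seq_ext (fun _ => 0)).
  - intros n; rewrite fdiffs_const; ring.
  - apply is_lim_seq_const.
Qed.

(** Rapid decay passes to differences, by induction on the order for all powers
    simultaneously. *)
Lemma log_like_rapid_decay (u : nat -> R) :
  (forall k, is_lim_seq (fun n => INR (S n) ^ k * u n) 0) -> log_like 0 u.
Proof.
  intros H k; rewrite Rmult_0_l; generalize (S k) at 1; generalize (S k).
  clear k; intros j; induction j as [|j IH]; intros k; [apply H|].
  apply (is_lim_seq_ext (fun n => INR (S n) ^ k * fdiffs j u (S n)
    - INR (S n) ^ k * fdiffs j u n)).
  - intros n; simpl; unfold fdiff at 3; ring.
  - replace 0 with (0 - 0) by ring; apply is_lim_seq_minus'; [|apply IH].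
    apply is_lim_seq_abs_0.
    assert (HS := IH k); apply is_lim_seq_incr_1, is_lim_seq_abs_0 in HS.
    apply (is_lim_seq_le_le (fun _ => 0) _ (fun n => Rabs (INR (S (S n)) ^ k * fdiffs j u (S n))));
      [|apply is_lim_seq_const|exact HS].
    intros n; split; [apply Rabs_pos|].
    rewrite !Rabs_mult; apply Rmult_le_compat_r; [apply Rabs_pos|].
    rewrite !Rabs_pos_eq by (apply pow_le, pos_INR).
    apply pow_incr; split; [apply pos_INR|apply le_INR; lia].
Qed.

(** The Leibniz rule for [w * (1 / w) = 1] is a recurrence in the order:
    [(w + k + 1) * fdiff^(k+1) (1 / w) = - (k + 1) * fdiff^k (1 / w)].  The
    shift [xi] may depend on the point of evaluation, as it does when it comes
    from the mean value theorem. *)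
Lemma fdiffs_inv_lim (c : R) (xi : nat -> R) (k : nat) :
  0 < c -> (forall n, 0 <= xi n <= 1) ->
  is_lim_seq (fun n => INR (S n) ^ S k * fdiffs k (fun m => / (INR m + c + xi n)) n)
    ((-1) ^ k * INR (fact k)).
Proof.
  intros Hc Hxi.
  assert (Hpos : forall m n, 0 < INR m + c + xi n).
  { intros m n; assert (0 <= INR m) by apply pos_INR; specialize (Hxi n); lra. }
  assert (Hratio : forall j, is_lim_seq (fun n => INR (S n) / (INR n + c + xi n + INR j)) 1).
  { intros j; apply (is_lim_seq_ratio_one _ (c + 1 + INR j + 1)); intros n;
      assert (0 <= INR j) by apply pos_INR.
    - specialize (Hpos n n); lra.
    - rewrite S_INR; specialize (Hxi n); apply Rabs_le; lra. }
  induction k as [|k IH].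
  - apply (is_lim_seq_ext (fun n => INR (S n) / (INR n + c + xi n + INR 0))).
    + intros n; simpl fdiffs; rewrite pow_1, Rplus_0_r; reflexivity.
    + replace (Finite ((-1) ^ 0 * INR (fact 0))) with (Finite 1) by (simpl; f_equal; ring).
      apply Hratio.
  - apply (is_lim_seq_ext (fun n => - INR (S k) *
      ((INR (S n) / (INR n + c + xi n + INR (S k))) *
       (INR (S n) ^ S k * fdiffs k (fun m => / (INR m + c + xi n)) n)))).
    + intros n.
      assert (H := fdiffs_leibniz (fun m => INR m + c + xi n)
        (fun m => / (INR m + c + xi n)) k n).
      rewrite (fdiffs_ext _ _ (fun _ => 1)), fdiffs_const in H
        by (intros m; apply Rinv_r; specialize (Hpos m n); lra).
      specialize (H (fun m => ltac:(rewrite S_INR; ring))).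
      set (D := fdiffs (S k) (fun m => / (INR m + c + xi n)) n) in *.
      set (D' := fdiffs k (fun m => / (INR m + c + xi n)) n) in *.
      assert (HW : 0 < INR n + c + xi n + INR (S k))
        by (specialize (Hpos n n); assert (0 <= INR (S k)) by apply pos_INR; lra).
      set (W := INR n + c + xi n + INR (S k)) in *.
      rewrite <- (tech_pow_Rmult _ (S k)).
      replace D with (- INR (S k) * D' / W); [field; lra|].
      apply (Rmult_eq_reg_l W); [|lra].
      replace (W * (- INR (S k) * D' / W)) with (- INR (S k) * D') by (field; lra); lra.
    + replace ((-1) ^ S k * INR (fact (S k))) with
        (- INR (S k) * (1 * ((-1) ^ k * INR (fact k))))
        by (rewrite fact_simpl, mult_INR; cbn [pow]; ring).
      apply is_lim_seq_mult'; [apply is_lim_seq_const|].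
      apply is_lim_seq_mult'; [apply Hratio|exact IH].
Qed.

Lemma is_derive_fdiffs_ln (c x : R) (k n : nat) : 0 < c + x ->
  is_derive (fun t => fdiffs k (fun m => ln (INR m + c + t)) n) x
    (fdiffs k (fun m => / (INR m + c + x)) n).
Proof.
  intros Hx; revert n; induction k as [|k IH]; intros n.
  - simpl; assert (0 <= INR n) by apply pos_INR; auto_derive; [lra|field; lra].
  - simpl; unfold fdiff at 1 3.
    apply (is_derive_minus (fun t => fdiffs k (fun m => ln (INR m + c + t)) (S n))
      (fun t => fdiffs k (fun m => ln (INR m + c + t)) n)); apply IH.
Qed.

(** One of the differences is the increment over [0 <= t <= 1] of the smooth
    function [t |-> fdiff^k (ln (m + c + t))]. *)
Lemma fdiffs_ln_mean_value (c : R) (k n : nat) : 0 < c ->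
  exists t, 0 <= t <= 1 /\
  fdiffs (S k) (fun m => ln (INR m + c)) n = fdiffs k (fun m => / (INR m + c + t)) n.
Proof.
  intros Hc.
  destruct (MVT_gen (fun t => fdiffs k (fun m => ln (INR m + c + t)) n) 0 1
    (fun t => fdiffs k (fun m => / (INR m + c + t)) n)) as (t & Ht & E).
  - intros x; rewrite Rmin_left, Rmax_right by lra; intros Hx.
    apply is_derive_fdiffs_ln; lra.
  - intros x; rewrite Rmin_left, Rmax_right by lra; intros Hx.
    apply continuity_pt_filterlim, @ex_derive_continuous.
    eexists; apply is_derive_fdiffs_ln; lra.
  - rewrite Rmin_left, Rmax_right in Ht by lra.
    exists t; split; [exact Ht|].
    rewrite Rminus_0_r, Rmult_1_r in E; rewrite <- E.
    rewrite (fdiffs_ext k (fun m => ln (INR m + c + 1)) (fun m => ln (INR (S m) + c)))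
      by (intros m; f_equal; rewrite S_INR; ring).
    rewrite (fdiffs_ext k (fun m => ln (INR m + c + 0)) (fun m => ln (INR m + c)))
      by (intros m; f_equal; ring).
    rewrite (fdiffs_shift k (fun m => ln (INR m + c))); reflexivity.
Qed.

Lemma log_like_ln (c : R) : 0 < c -> log_like 1 (fun n => ln (INR n + c)).
Proof.
  intros Hc k.
  set (pt n := constructive_indefinite_description _ (fdiffs_ln_mean_value c k n Hc)).
  rewrite Rmult_1_l.
  apply (is_lim_seq_ext (fun n => INR (S n) ^ S k *
    fdiffs k (fun m => / (INR m + c + proj1_sig (pt n))) n)).
  - intros n; f_equal; symmetry; apply (proj2_sig (pt n)).
  - apply (fdiffs_inv_lim c (fun n => proj1_sig (pt n))); [exact Hc|].
    intros n; apply (proj2_sig (pt n)).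
Qed.

(** Let [p n = n + 1] and [h = a / p].  The sequence [p * fdiff a - a] has
    difference [(p + 1) * fdiff^2 a], which tends to [l]; its Cesaro mean is
    [fdiff a - h = (p + 1) * fdiff h], which gives the first order.  For higher
    orders, the Leibniz rule for [a = p * h] expresses [fdiff^(k+2) h] by
    [fdiff^(k+2) a] and [fdiff^(k+1) h], and the limits match since
    [1 - (k + 2) = - (k + 1)]. *)
Lemma log_like_mean (l : R) (a : nat -> R) :
  log_like l (fdiff a) -> log_like l (fun n => a n / INR (S n)).
Proof.
  intros Ha.
  set (h := fun n => a n / INR (S n)).
  assert (Hp : forall n, 0 < INR (S n)) by (intros; apply lt_0_INR; lia).
  assert (Hah : forall n, INR (S n) * h n = a n)
    by (intros n; unfold h; field; specialize (Hp n); lra).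
  assert (Hratio : forall j, is_lim_seq (fun n => (INR (S n) + INR j) / INR (S n)) 1
    /\ is_lim_seq (fun n => INR (S n) / (INR (S n) + INR j)) 1).
  { intros j; apply (is_lim_seq_ratio_one _ (INR j)); intros n;
      assert (0 <= INR j) by apply pos_INR.
    - specialize (Hp n); lra.
    - apply Rabs_le; lra. }
  assert (HL : forall k n, fdiffs (S k) a n =
    (INR (S n) + INR (S k)) * fdiffs (S k) h n + INR (S k) * fdiffs k h n).
  { intros k n.
    rewrite <- (fdiffs_leibniz (fun m => INR (S m)) h k n) by (intros; apply S_INR).
    apply fdiffs_ext; intros; now rewrite Hah. }
  intros k; induction k as [|k IH].
  - assert (He : is_lim_seq (fun n => (INR (S n) * fdiff a n - a n) / INR (S n)) l).
    { apply (is_lim_seq_cesaro (fun n => INR (S n) * fdiff a n - a n)).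
      apply (is_lim_seq_ext (fun n => (INR (S n) + INR 1) / INR (S n) *
        (INR (S n) ^ 1 * fdiffs 1 (fdiff a) n))).
      - intros n; specialize (Hp n); rewrite (S_INR (S n)); simpl fdiffs.
        unfold fdiff; simpl (INR 1); field; lra.
      - replace (Finite l) with (Finite (1 * (l * ((-1) ^ 0 * INR (fact 0)))))
          by (f_equal; simpl; ring).
        apply is_lim_seq_mult'; [apply Hratio|apply (Ha 0%nat)]. }
    apply (is_lim_seq_ext (fun n => INR (S n) / (INR (S n) + INR 1) *
      ((INR (S n) * fdiff a n - a n) / INR (S n)))).
    + intros n; assert (H := HL 0%nat n); change (fdiffs 1 a n) with (fdiff a n) in H.
      specialize (Hp n); rewrite H, pow_1, <- (Hah n); simpl (fdiffs 0 h n).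
      simpl (INR 1); field; lra.
    + replace (Finite (l * _)) with (Finite (1 * l)) by (f_equal; simpl; ring).
      apply is_lim_seq_mult'; [apply Hratio|exact He].
  - apply (is_lim_seq_ext (fun n => INR (S n) / (INR (S n) + INR (S (S k))) *
      (INR (S n) ^ S k * fdiffs (S k) (fdiff a) n
       - INR (S (S k)) * (INR (S n) ^ S k * fdiffs (S k) h n)))).
    + intros n; rewrite <- Nat.iter_succ_r, HL.
      specialize (Hp n); assert (0 <= INR (S (S k))) by apply pos_INR.
      rewrite <- (tech_pow_Rmult _ (S k)); field; lra.
    + replace (l * ((-1) ^ S k * INR (fact (S k)))) with
        (1 * (l * ((-1) ^ k * INR (fact k))
          - INR (S (S k)) * (l * ((-1) ^ k * INR (fact k)))))
        by (rewrite fact_simpl, mult_INR, (S_INR (S k)); cbn [pow]; ring).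
      apply is_lim_seq_mult'; [apply Hratio|].
      apply is_lim_seq_minus'; [apply Ha|].
      apply is_lim_seq_mult'; [apply is_lim_seq_const|exact IH].
Qed.

(** * Differences of the logarithm of the Bernoulli numbers *)

Lemma ln_zeta_even_bounds (n : nat) : 0 <= ln (zeta_even n) <= (/ 4) ^ n.
Proof.
  destruct (zeta_even_bounds n) as [H1 H2]; split.
  - rewrite <- ln_1; destruct H1 as [H1| <-]; [apply Rlt_le, ln_increasing; lra|lra].
  - assert (H := exp_ineq1_le (ln (zeta_even n))); rewrite exp_ln in H by lra; lra.
Qed.

Lemma log_like_ln_zeta_even : log_like 0 (fdiff (fun n => ln (zeta_even n))).
Proof.
  assert (H : forall k, is_lim_seq (fun n => INR (S n) ^ k * ln (zeta_even n)) 0).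
  { intros k; apply (is_lim_seq_le_le (fun _ => 0) _ (fun n => INR (S n) ^ k * (/ 4) ^ n)).
    - intros n; assert (Hz := ln_zeta_even_bounds n).
      assert (0 <= INR (S n) ^ k) by apply pow_le, pos_INR; split; nra.
    - apply is_lim_seq_const.
    - apply pow_mult_geom_lim. }
  apply log_like_rapid_decay; intros k.
  apply (is_lim_seq_le_le (fun n => - (INR (S n) ^ k * ln (zeta_even n))) _
    (fun n => INR (S (S n)) ^ k * ln (zeta_even (S n)))).
  - intros n; assert (Hz := ln_zeta_even_bounds n); assert (Hz' := ln_zeta_even_bounds (S n)).
    assert (0 <= INR (S n) ^ k) by apply pow_le, pos_INR.
    assert (INR (S n) ^ k <= INR (S (S n)) ^ k)
      by (apply pow_incr; split; [apply pos_INR|apply le_INR; lia]).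
    unfold fdiff; split; nra.
  - replace (Finite 0) with (Finite (- 0)) by (f_equal; ring).
    apply (is_lim_seq_opp _ 0), H.
  - apply -> (is_lim_seq_incr_1 (fun n => INR (S n) ^ k * ln (zeta_even n))); apply H.
Qed.

Definition ln_bernoulli (n : nat) : R := ln (Rabs (bernoulli (2 * S n))).

Lemma Rabs_bernoulli_even_pos (n : nat) : 0 < Rabs (bernoulli (2 * S n)).
Proof.
  rewrite Rabs_bernoulli_even.
  assert (Hf := INR_fact_lt_0 (2 * S n)).
  assert (Hr := pow_lt _ (S n) rho_pos).
  assert (Hz := zeta_even_bounds n).
  apply Rdiv_lt_0_compat; nra.
Qed.

(** The factorials contribute [(2n + 3) (2n + 4) = 4 (n + 3/2) (n + 2)]. *)
Lemma fdiff_ln_bernoulli (n : nat) :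
  fdiff ln_bernoulli n =
  ln (4 / rho) + ln (INR n + 3 / 2) + ln (INR n + 2)
  + fdiff (fun m => ln (zeta_even m)) n.
Proof.
  assert (Hr := rho_pos); assert (Hn := pos_INR n).
  assert (Hz := zeta_even_bounds n); assert (Hz' := zeta_even_bounds (S n)).
  assert (Hf := INR_fact_lt_0 (2 * S n)); assert (Hp := pow_lt _ (S n) Hr).
  assert (HB := Rabs_bernoulli_even_pos n).
  assert (E : Rabs (bernoulli (2 * S (S n))) * zeta_even n =
    4 / rho * (INR n + 3 / 2) * (INR n + 2) * zeta_even (S n)
    * Rabs (bernoulli (2 * S n))).
  { rewrite !Rabs_bernoulli_even.
    replace (2 * S (S n))%nat with (S (S (2 * S n))) by lia.
    rewrite !fact_simpl, !mult_INR, (S_INR (S (2 * S n))), (S_INR (2 * S n)),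
      mult_INR, (S_INR n), <- (tech_pow_Rmult rho (S n)).
    replace (INR 2) with 2 by (simpl; ring); field; lra. }
  apply (f_equal ln) in E.
  assert (0 < 4 / rho) by (apply Rdiv_lt_0_compat; lra).
  rewrite !ln_mult in E;
    try (repeat apply Rmult_lt_0_compat; try apply Rabs_bernoulli_even_pos; lra).
  unfold fdiff, ln_bernoulli; lra.
Qed.

Lemma log_like_fdiff_ln_bernoulli : log_like 2 (fdiff ln_bernoulli).
Proof.
  eapply log_like_ext; [intros n; symmetry; apply fdiff_ln_bernoulli|].
  replace 2 with (0 + 1 + 1 + 0) at 1 by ring.
  repeat apply log_like_plus.
  - apply log_like_const.
  - apply log_like_ln; lra.
  - apply log_like_ln; lra.
  - apply log_like_ln_zeta_even.
Qed.

Lemma log_like_alternates (l : R) (u : nat -> R) (k : nat) :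
  0 < l -> log_like l u ->
  exists N, forall n, (N <= n)%nat -> 0 < (-1) ^ k * fdiffs (S k) u n.
Proof.
  intros Hl Hu.
  assert (H : is_lim_seq (fun n => (-1) ^ k * (INR (S n) ^ S k * fdiffs (S k) u n))
    ((-1) ^ k * (l * ((-1) ^ k * INR (fact k)))))
    by (apply is_lim_seq_mult'; [apply is_lim_seq_const|apply Hu]).
  assert (E : (-1) ^ k * (-1) ^ k = 1)
    by (rewrite <- Rpow_mult_distr; replace (-1 * -1) with 1 by ring; apply pow1).
  replace ((-1) ^ k * (l * ((-1) ^ k * INR (fact k)))) with (l * INR (fact k)) in H
    by (transitivity ((-1) ^ k * (-1) ^ k * (l * INR (fact k))); [rewrite E|]; ring).
  assert (Hf := INR_fact_lt_0 k).
  apply is_lim_seq_Reals in H; destruct (H (l * INR (fact k))) as [N HN]; [nra|].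
  exists N; intros n Hn; specialize (HN n Hn); unfold Rdist in HN.
  apply Rabs_def2 in HN.
  assert (0 < INR (S n) ^ S k) by (apply pow_lt, lt_0_INR; lia).
  apply (Rmult_lt_reg_l (INR (S n) ^ S k)); lra.
Qed.

Lemma ratio_seq_iter_exp (z L : nat -> R) (r n : nat) :
  (forall m, z m = exp (L m)) -> ratio_seq_iter r z n = exp (fdiffs r L n).
Proof.
  intros Hz; revert n; induction r as [|r IH]; intros n; [apply Hz|].
  change (ratio_seq (ratio_seq_iter r z) n = exp (fdiff (fdiffs r L) n)).
  unfold ratio_seq, fdiff; rewrite !IH, Nat.add_1_r.
  unfold Rminus, Rdiv; now rewrite exp_plus, exp_Ropp.
Qed.

Lemma exp_sq_le (x y z : R) : 0 <= x - 2 * y + z -> exp y ^ 2 <= exp x * exp z.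
Proof.
  intros H; rewrite <- exp_plus; cbn [pow]; rewrite Rmult_1_r, <- exp_plus.
  destruct (Req_dec (y + y) (x + z)) as [->|]; [lra|].
  apply Rlt_le, exp_increasing; lra.
Qed.

Lemma exp_sq_ge (x y z : R) : x - 2 * y + z <= 0 -> exp y ^ 2 >= exp x * exp z.
Proof.
  intros H; rewrite <- exp_plus; cbn [pow]; rewrite Rmult_1_r, <- exp_plus.
  destruct (Req_dec (y + y) (x + z)) as [->|]; [lra|].
  apply Rgt_ge, exp_increasing; lra.
Qed.

(** The second difference of [fdiff^r] of the logarithm decides between
    log-convexity and log-concavity of the [r]-th iterate, and it is
    [- fdiff^(r+2) h], of sign [(-1)^r]. *)
Lemma almost_infinitely_log_monotonic_exp_opp (l : R) (h z : nat -> R) :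
  0 < l -> log_like l h -> (forall n, z n = exp (- h n)) ->
  almost_infinitely_log_monotonic z.
Proof.
  intros Hl Hh Hz; split; [intros n; rewrite Hz; apply exp_pos|].
  intros r; destruct (log_like_alternates l h (S r) Hl Hh) as [N HN]; exists N.
  assert (HR : forall n, ratio_seq_iter r z n = exp (- fdiffs r h n))
    by (intros n; rewrite <- fdiffs_opp; now apply ratio_seq_iter_exp).
  assert (HD : forall n, fdiffs (S (S r)) h n =
    fdiffs r h (S (S n)) - 2 * fdiffs r h (S n) + fdiffs r h n)
    by (intros n; change (fdiffs (S (S r)) h n) with
      (fdiffs r h (S (S n)) - fdiffs r h (S n) - (fdiffs r h (S n) - fdiffs r h n)); ring).
  assert (Hpos : positive_seq (tail_seq N (ratio_seq_iter r z)))
    by (intros n; unfold tail_seq; rewrite HR; apply exp_pos).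
  split; intros Hr; (split; [exact Hpos|]); intros n; unfold tail_seq; rewrite !HR;
    replace (N + (n + 1))%nat with (S (N + n)) by lia;
    replace (N + (n + 2))%nat with (S (S (N + n))) by lia;
    specialize (HN (N + n)%nat ltac:(lia)); rewrite HD in HN; cbn [pow] in HN;
    destruct Hr as [j ->].
  - rewrite pow_1_even in HN; apply exp_sq_le; lra.
  - rewrite Nat.add_1_r, pow_1_odd in HN; apply exp_sq_ge; rewrite Nat.add_1_r; lra.
Qed.

Theorem corollary3p10 :
  almost_infinitely_log_monotonic
    (fun m : nat => let n := S m in 1 / nth_root n (Rabs (bernoulli (2 * n)))).
Proof.
  apply (almost_infinitely_log_monotonic_exp_opp 2 (fun m => ln_bernoulli m / INR (S m)));
    [lra|apply log_like_mean, log_like_fdiff_ln_bernoulli|].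
  intros m; cbv zeta; unfold nth_root.
  destruct (Rlt_dec 0 (Rabs (bernoulli (2 * S m)))) as [_|Hn];
    [|now destruct (Hn (Rabs_bernoulli_even_pos m))].
  rewrite exp_Ropp; unfold Rdiv, Rpower, ln_bernoulli.
  now rewrite Rmult_1_l, (Rmult_comm (/ INR (S m))).
Qed.
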